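(* Let $\lambda$ be a partition of length $\ell$. Then $G_{1^\ell}^{\perp}\, g_{\lambda} = g_{\lambda-1^\ell}$, where $\lambda-1^\ell=(\lambda_1-1,\ldots,\lambda_\ell-1)$.
   Context: $e_d$ and $h_d$ denote the elementary and complete homogeneous symmetric functions ($h_0=e_0=1$, $h_d=0$ for $d<0$). For $m\in\mathbb{Z}$ and $r\in\mathbb{Z}_{\ge 0}$ put $k_m^{(r)}:=\sum_{i=0}^{m}\binom{r+i-1}{i}h_{m-i}$, with the conventions $k_m^{(r)}=0$ for $m<0$ and $k_m^{(0)}=h_m$. For $\gamma\in\mathbb{Z}^\ell$ define $g_\gamma:=\det\big(k^{(i-1)}_{\gamma_i+j-i}\big)_{1\le i,j\le \ell}$ (when $\gamma$ is a partition this is the dual stable Grothendieck polynomial). For $m\in\mathbb{Z}_{\geq 0}$, $G_{1^m}:=\sum_{i\ge 0}(-1)^i\binom{m-1+i}{m-1}e_{m+i}$ (with $G_{1^0}=1$). For a symmetric function $f$, $f^\perp$ is the linear operator on symmetric functions adjoint to multiplication by $f$ with respect to the Hall inner product: $\langle f^\perp p,q\rangle=\langle p,fq\rangle$; $f\mapsto f^\perp$ is extended linearly to the infinite sum $G_{1^m}$, i.e. $G_{1^m}^\perp=\sum_{i\ge0}(-1)^i\binom{m-1+i}{m-1}e_{m+i}^\perp$, which is a finite sum when applied to any given symmetric function. *)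

(* Defs.v *)
From HB Require Import structures.
From mathcomp Require Import all_boot all_order all_fingroup all_algebra.
From mathcomp Require Import boolp classical_sets fsbigop.
From mathcomp Require Import mpoly.

Set Implicit Arguments.
Unset Strict Implicit.
Unset Printing Implicit Defensive.

Import Order.TTheory GRing.Theory.

Local Open Scope ring_scope.

(* The specialization x_n := 0, from n.+1 to n variables. *)
Definition mrestrict (n : nat) (R : comNzRingType) (p : {mpoly R[n.+1]}) :
    {mpoly R[n]} :=
  p \mPo [tuple if unlift ord_max i is Some j then 'X_j else 0 | i < n.+1].

Section SymmetricFunctions.
Context (R : comNzRingType).

(* The ring of symmetric functions over R, as the graded inverse limit of the
   rings of symmetric polynomials in n variables: compatible families
   f_n(x_0, ..., x_(n-1)) of uniformly bounded degree. *)
Definition symfun_axiom (f : forall n, {mpoly R[n]}) : Prop :=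
  [/\ forall n, f n \is symmetric,
      forall n, mrestrict (f n.+1) = f n
    & exists d, forall n, (msize (f n) <= d)%N].

Record symfun := Symfun {
  sf_val :> forall n, {mpoly R[n]};
  sf_valP : `[< symfun_axiom sf_val >] }.

HB.instance Definition _ := [isSub for sf_val].
HB.instance Definition _ := [Choice of symfun by <:].

Lemma sfP (f : symfun) : symfun_axiom f.
Proof. exact/asboolP/sf_valP. Qed.

Lemma sf_eqP (f g : symfun) : (forall n, f n = g n) -> f = g.
Proof. by move=> fg; apply/val_inj/functional_extensionality_dep. Qed.

Lemma mcoeff_mrestrict n (p : {mpoly R[n.+1]}) (m : 'X_{1..n}) :
  (mrestrict p)@_m = p@_(mnmwiden m).
Proof.
rewrite {2}[p]mpolyE /mrestrict comp_mpolyE !raddf_sum /=.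
apply: eq_bigr => m' _; rewrite !mcoeffZ; congr (_ * _).
rewrite mcoeffX big_ord_recr /= tnth_mktuple unlift_none.
have -> : \prod_(i < n) tnth [tuple if unlift ord_max i is Some j then 'X_j
      else 0 | i < n.+1] (widen_ord (leqnSn n) i) ^+ m' (widen_ord (leqnSn n) i)
    = 'X_[[multinom m' (widen_ord (leqnSn n) i) | i < n]] :> {mpoly R[n]}.
  rewrite [RHS]mpolyXE_id; apply: eq_bigr => i _; rewrite tnth_mktuple mnmE.
  have -> : widen_ord (leqnSn n) i = lift ord_max i.
    by apply/val_inj; rewrite /= /bump leqNgt ltn_ord.
  by rewrite liftK.
have [m0|m0] := eqVneq (m' ord_max) 0%N.
  rewrite m0 expr0 mulr1 mcoeffX; congr (_%:R); congr (nat_of_bool _).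
  apply/eqP/eqP => [<-|->].
    apply/mnmP => i; have [j ->|->] := unliftP ord_max i.
      have -> : lift ord_max j = widen_ord (leqnSn n) j.
        by apply/val_inj; rewrite /= /bump leqNgt ltn_ord.
      by rewrite mnmwiden_widen mnmE.
    by rewrite mnmwiden_ordmax.
  by apply/mnmP => i; rewrite mnmE mnmwiden_widen.
rewrite expr0n (negbTE m0) mulr0 mcoeff0.
case: eqP => // mm; move: m0; rewrite mm mnmwiden_ordmax eqxx //.
Qed.

Lemma sf_zero_subproof : `[< symfun_axiom (fun n => 0) >].
Proof.
apply/asboolP; split=> [n|n|]; first exact: rpred0.
  exact: raddf0.
by exists 0%N => n; rewrite msize0.
Qed.

Lemma sf_one_subproof : `[< symfun_axiom (fun n => 1) >].
Proof.
apply/asboolP; split=> [n|n|]; first exact: rpred1.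
  exact: rmorph1.
by exists 1%N => n; rewrite msize1.
Qed.

Lemma sf_opp_subproof (f : symfun) : `[< symfun_axiom (fun n => - f n) >].
Proof.
have [fs fr [d fd]] := sfP f; apply/asboolP; split=> [n|n|].
- by rewrite rpredN fs.
- by rewrite -[in RHS]fr /mrestrict raddfN.
- by exists d => n; rewrite msizeN.
Qed.

Lemma sf_add_subproof (f g : symfun) :
  `[< symfun_axiom (fun n => f n + g n) >].
Proof.
have [fs fr [d fd]] := sfP f; have [gs gr [d' gd]] := sfP g.
apply/asboolP; split=> [n|n|].
- by rewrite rpredD ?fs ?gs.
- by rewrite -[in RHS]fr -[in RHS]gr /mrestrict raddfD.
- exists (maxn d d') => n; apply: leq_trans (msizeD_le _ _) _.
  by rewrite geq_max !leq_max fd gd orbT.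
Qed.

Lemma sf_mul_subproof (f g : symfun) :
  `[< symfun_axiom (fun n => f n * g n) >].
Proof.
have [fs fr [d fd]] := sfP f; have [gs gr [d' gd]] := sfP g.
apply/asboolP; split=> [n|n|].
- by rewrite rpredM ?fs ?gs.
- by rewrite -[in RHS]fr -[in RHS]gr /mrestrict rmorphM.
- exists (d + d')%N.+1 => n; apply: leq_trans (msizeM_le _ _) _.
  by rewrite ltnS leq_add.
Qed.

Lemma sf_scale_subproof (c : R) (f : symfun) :
  `[< symfun_axiom (fun n => c *: f n) >].
Proof.
have [fs fr [d fd]] := sfP f; apply/asboolP; split=> [n|n|].
- by rewrite rpredZ ?fs.
- by rewrite -[in RHS]fr /mrestrict linearZ.
- by exists d => n; apply: leq_trans (msizeZ_le _ _) (fd n).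
Qed.

Definition sf_zero := Symfun sf_zero_subproof.
Definition sf_one := Symfun sf_one_subproof.
Definition sf_opp f := Symfun (sf_opp_subproof f).
Definition sf_add f g := Symfun (sf_add_subproof f g).
Definition sf_mul f g := Symfun (sf_mul_subproof f g).
Definition sf_scale c f := Symfun (sf_scale_subproof c f).

Lemma sf_addA : associative sf_add.
Proof. by move=> f g h; apply: sf_eqP => n; apply: addrA. Qed.
Lemma sf_addC : commutative sf_add.
Proof. by move=> f g; apply: sf_eqP => n; apply: addrC. Qed.
Lemma sf_add0 : left_id sf_zero sf_add.
Proof. by move=> f; apply: sf_eqP => n; apply: add0r. Qed.
Lemma sf_addN : left_inverse sf_zero sf_opp sf_add.
Proof. by move=> f; apply: sf_eqP => n; apply: addNr. Qed.

HB.instance Definition _ :=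
  GRing.isZmodule.Build symfun sf_addA sf_addC sf_add0 sf_addN.

Lemma sf_mulA : associative sf_mul.
Proof. by move=> f g h; apply: sf_eqP => n; apply: mulrA. Qed.
Lemma sf_mulC : commutative sf_mul.
Proof. by move=> f g; apply: sf_eqP => n; apply: mulrC. Qed.
Lemma sf_mul1 : left_id sf_one sf_mul.
Proof. by move=> f; apply: sf_eqP => n; apply: mul1r. Qed.
Lemma sf_mulDl : left_distributive sf_mul sf_add.
Proof. by move=> f g h; apply: sf_eqP => n; apply: mulrDl. Qed.
Lemma sf_oner_neq0 : sf_one != 0.
Proof.
apply/eqP => /(congr1 (fun f : symfun => f 0%N)) /= /eqP.
by rewrite oner_eq0.
Qed.

HB.instance Definition _ := GRing.Zmodule_isComNzRing.Build symfun
  sf_mulA sf_mulC sf_mul1 sf_mulDl sf_oner_neq0.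

Lemma sf_scaleA c d f : sf_scale c (sf_scale d f) = sf_scale (c * d) f.
Proof. by apply: sf_eqP => n; apply: scalerA. Qed.
Lemma sf_scale1 : left_id 1 sf_scale.
Proof. by move=> f; apply: sf_eqP => n; apply: scale1r. Qed.
Lemma sf_scaleDr : right_distributive sf_scale +%R.
Proof. by move=> c f g; apply: sf_eqP => n; apply: scalerDr. Qed.
Lemma sf_scaleDl f : {morph sf_scale^~ f : c d / c + d}.
Proof. by move=> c d; apply: sf_eqP => n; apply: scalerDl. Qed.

HB.instance Definition _ := GRing.Zmodule_isLmodule.Build R symfun
  sf_scaleA sf_scale1 sf_scaleDr sf_scaleDl.

Lemma sf_scaleAl (c : R) (f g : symfun) : c *: (f * g) = (c *: f) * g.
Proof. by apply: sf_eqP => n; apply: scalerAl. Qed.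

HB.instance Definition _ := GRing.Lmodule_isLalgebra.Build R symfun sf_scaleAl.
HB.instance Definition _ := GRing.Lalgebra_isComAlgebra.Build R symfun.

Lemma sf_elem_subproof d : `[< symfun_axiom (fun n => mesym n R d) >].
Proof.
apply/asboolP; split=> [n|n|]; first exact: mesym_sym.
  apply/mpolyP => m; rewrite mcoeff_mrestrict !mcoeff_mesym.
  congr (_%:R); congr (nat_of_bool _); rewrite /mechar !mdegE big_ord_recr /=.
  rewrite mnmwiden_ordmax addn0.
  under eq_bigr do rewrite mnmwiden_widen.
  congr (_ && _); apply/forallP/forallP => [mle i|mle i].
    by have := mle (widen_ord (leqnSn n) i); rewrite mnmwiden_widen.
  have [j ->|->] := unliftP ord_max i; last by rewrite mnmwiden_ordmax.
  have -> : lift ord_max j = widen_ord (leqnSn n) j.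
    by apply/val_inj; rewrite /= /bump leqNgt ltn_ord.
  by rewrite mnmwiden_widen.
exists d.+1 => n; rewrite /mmeasure; apply/bigmax_leqP_seq => m.
by rewrite mem_msupp_mesym /= => /andP[/eqP ->].
Qed.

Definition sf_elem d := Symfun (sf_elem_subproof d).

(* The sum of the monomials of degree d whose exponents satisfy P, where P must
   not depend on the order of the exponents or on the zero ones. *)
Definition msum_of n (d : nat) (P : pred (seq nat)) : {mpoly R[n]} :=
  \sum_(m : 'X_{1..n < d.+1} | (mdeg m == d) && P [seq k <- m | k != 0%N])
     'X_[m].

Lemma mcoeff_msum_of n d P (m : 'X_{1..n}) :
  (msum_of n d P)@_m = ((mdeg m == d) && P [seq k <- m | k != 0%N])%:R.
Proof.
rewrite /msum_of raddf_sum /=; under eq_bigr do rewrite mcoeffX.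
case: (boolP (_ && _)) => [/andP[mE Pm]|nPm]; last first.
  rewrite big1 // => m' Pm'; case: eqP => // mm'.
  by move: nPm; rewrite -mm' Pm'.
have mlt : (mdeg m < d.+1)%N by rewrite (eqP mE).
rewrite (bigD1 (BMultinom mlt)) /= ?mE //= eqxx big1 ?addr0 // => m' /andP[_].
by rewrite -val_eqE /= => /negbTE ->.
Qed.

Lemma msum_of_subproof d (P : pred (seq nat)) :
    (forall s t, perm_eq s t -> P s = P t) ->
  `[< symfun_axiom (fun n => msum_of n d P) >].
Proof.
move=> permP; apply/asboolP; split=> [n|n|].
- apply/issymP => s; apply/mpolyP => m; rewrite mcoeff_sym !mcoeff_msum_of.
  have ms : perm_eq [multinom m (s i) | i < n] m.
    by apply/tuple_permP; exists s.
  congr (_%:R); congr (nat_of_bool _); congr (_ && _); last first.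
    by apply: permP; apply: perm_filter.
  by rewrite /mdeg (perm_big _ ms).
- apply/mpolyP => m; rewrite mcoeff_mrestrict !mcoeff_msum_of /mdeg /=.
  congr (_%:R); congr (nat_of_bool _).
  by rewrite filter_rcons /= -cats1 big_cat big_seq1 /= addn0.
- exists d.+1 => n; rewrite /mmeasure; apply/bigmax_leqP_seq => m.
  rewrite mcoeff_msupp mcoeff_msum_of /=.
  by case: (boolP (_ == d)) => [/eqP ->|]; rewrite ?eqxx.
Qed.

Definition sf_complete d : symfun :=
  @Symfun (fun n => msum_of n d xpredT) (@msum_of_subproof d xpredT (fun _ _ _ => erefl)).

Lemma sf_monomial_subproof (la s t : seq nat) :
  perm_eq s t -> perm_eq la s = perm_eq la t.
Proof. by move/permPr. Qed.

Definition sf_monomial (la : seq nat) : symfun :=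
  @Symfun (fun n => msum_of n (sumn la) (perm_eq la))
    (msum_of_subproof (sumn la) (@sf_monomial_subproof la)).

Definition sf_complete_prod (la : seq nat) : symfun :=
  \prod_(d <- la) sf_complete d.

(* A partition is the decreasing sequence of its nonzero parts, so that its
   length is its size as a sequence. *)
Definition is_part (la : seq nat) : bool := sorted geq la && (0%N \notin la).

(* The Hall inner product is the bilinear form for which the bases h_lambda and
   m_mu are dual; as they are bases, xget picks the only such form. That form is
   nondegenerate, so xget also picks the only adjoint operator in perp. *)
Definition is_hall (B : symfun -> symfun -> R) : Prop :=
  [/\ forall p, scalar (B p),
      forall q, scalar (B^~ q)
    & forall la mu, is_part la -> is_part mu ->
        B (sf_complete_prod la) (sf_monomial mu) = (la == mu)%:R].

Definition hall : symfun -> symfun -> R := xget (fun _ _ => 0) is_hall.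

Definition is_perp (f : symfun) (T : symfun -> symfun) : Prop :=
  linear T /\ forall p q, hall (T p) q = hall p (f * q).

Definition perp (f : symfun) : symfun -> symfun := xget (fun _ => 0) (is_perp f).

(* An infinite sum of symmetric functions is given by the sequence F of its
   terms. As perp is linear in the symmetric function, it extends to such a sum
   termwise; the sum below is the sum of the nonzero terms, which are finitely
   many if deg (F i) tends to infinity. *)
Definition perp_series (F : nat -> symfun) (p : symfun) : symfun :=
  \sum_(i \in [set: nat]) perp (F i) p.

(* The term of index i of the infinite sum G_{1^m}. *)
Definition G1 (m : nat) (i : nat) : symfun :=
  if m is 0 then (i == 0%N)%:R
  else ((-1) ^+ i * 'C((m - 1 + i)%N, (m - 1)%N)%:R) *: sf_elem (m + i).

(* Truncated predecessor is harmless: for r = 0, the convention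
   k_m^(0) = h_m holds as 'C(0, 0) = 1 and 'C(i.-1, i) = 0 for i > 0. *)
Definition kfun (r : nat) (m : int) : symfun :=
  if m is Posz n then
    \sum_(i < n.+1) 'C((r + i).-1, i)%:R *: sf_complete (n - i)
  else 0.

(* Rows are numbered from 0, so that row i has superscript i, not i - 1. *)
Definition dual_grothendieck (l : nat) (gamma : 'I_l -> int) : symfun :=
  \det (\matrix_(i < l, j < l) kfun i (gamma i + j%:Z - i%:Z)).

End SymmetricFunctions.

(* Main.v *)
Require Import Defs.
From HB Require Import structures.
From mathcomp Require Import all_boot all_order all_fingroup all_algebra.
From mathcomp Require Import boolp classical_sets fsbigop.
From mathcomp Require Import mpoly.

Set Implicit Arguments.
Unset Strict Implicit.
Unset Printing Implicit Defensive.

Import Order.TTheory GRing.Theory.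

Local Open Scope ring_scope.

(** Skewing by elementary functions is a ring homomorphism: for a formal
    variable X, the map p |-> sum_n (perp e_n p) X^n is multiplicative, because
    e_n is the degree n part of prod_i (1 + X x_i). It sends h_d to
    h_d + h_(d-1) X, hence k_m^(r) to k_m^(r) + k_(m-1)^(r) X, whatever r.
    So it sends the l x l determinant g_lambda to the determinant with entries
    k + k' X, where k' is the entry of g_(lambda - 1^l). That determinant has
    degree at most l in X, and its coefficient of X^l is g_(lambda - 1^l). So
    perp e_l g_lambda = g_(lambda - 1^l) and perp e_n g_lambda = 0 for n > l;
    as G_(1^l) is e_l plus multiples of e_n with n > l, the theorem follows
    (perp_elem_det, skews_to_kfun).

    Speaking of perp requires that the Hall form exists over an arbitrary
    commutative ring, that is, that the products h_la are a basis. They span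
    (hspanP), since the e_d generate and the relation
    sum_i (-1)^i e_i h_(n-i) = 0 expresses e_n by complete functions. In
    degrees at most N there are as many products h_la as monomial functions,
    so the transition matrix is square; having a one-sided inverse, it is
    invertible, and the h_la are free (hprod_free). A linear map may thus be
    prescribed on them (linear_ext_exists), which yields the Hall form, and
    the adjoint of e_n: its value on h_s is the coefficient of X^n in
    prod_i (h_(s_i) + h_(s_i - 1) X), since pairing with h_s extracts the
    coefficient of x^s (hall_hprod, hall_coef_hpoly). *)

(** * Partitions and exponent vectors *)

Definition shape_of (s : seq nat) : seq nat :=
  sort geq [seq k <- s | k != 0%N].

Lemma geq_total : total geq.
Proof. by move=> x y /=; exact: leq_total. Qed.

Lemma geq_trans : transitive geq.
Proof. by move=> y x z /= yx zy; exact: leq_trans zy yx. Qed.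

Lemma geq_anti : antisymmetric geq.
Proof. by move=> x y /= /andP[yx xy]; apply/eqP; rewrite eqn_leq xy yx. Qed.

Lemma is_part_shape s : is_part (shape_of s).
Proof.
rewrite /is_part sort_sorted ?mem_sort ?mem_filter //; exact: geq_total.
Qed.

Lemma filter_part la : is_part la -> [seq k <- la | k != 0%N] = la.
Proof.
case/andP=> _ la0; apply/all_filterP/allP => k kla.
by apply: contraNneq la0 => <-.
Qed.

Lemma part_perm la mu : is_part la -> is_part mu -> perm_eq la mu = (la == mu).
Proof.
case/andP=> sla _ /andP[smu _]; apply/idP/eqP => [pe|-> //].
exact: (sorted_eq geq_trans geq_anti).
Qed.

(** Up to order, an exponent vector is a partition padded with zeros; this reduces
    every coefficient to one indexed by a partition. *)
Lemma shape_perm s : perm_eq s (shape_of s ++ nseq (count_mem 0%N s) 0%N).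
Proof.
rewrite perm_sym; apply: perm_trans (_ : perm_eq _ ([seq k <- s | k != 0%N] ++
  [seq k <- s | ~~ (k != 0%N)])) _; last by rewrite perm_filterC.
apply: perm_cat; first by rewrite perm_sort.
rewrite -size_filter; set t := filter _ s; set t' := filter _ s.
have -> : t' = t by apply: eq_filter => x /=; rewrite negbK.
suff /all_pred1P <- : all (pred1 0%N) t by [].
exact: filter_all.
Qed.

Lemma sumn_shape s : sumn (shape_of s) = sumn s.
Proof.
by rewrite (perm_sumn (shape_perm s)) sumn_cat sumn_nseq mul0n addn0.
Qed.

Lemma size_part la : is_part la -> (size la <= sumn la)%N.
Proof.
case/andP=> _; elim: la => //= k la IH; rewrite inE negb_or eq_sym -lt0n.
by case/andP=> k0 /IH; rewrite -add1n; apply: leq_add.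
Qed.

(** A partition of sum at most N has at most N parts, each at most N, hence lies
    in a finite type of bounded sequences. *)
Definition parts_upto (N : nat) : seq (seq nat) :=
  undup [seq la <- [seq [seq val k | k <- val t]
                   | t : {bseq N of 'I_N.+1}] | is_part la && (sumn la <= N)%N].

Lemma parts_upto_uniq N : uniq (parts_upto N).
Proof. exact: undup_uniq. Qed.

Lemma mem_parts N la : (la \in parts_upto N) = is_part la && (sumn la <= N)%N.
Proof.
rewrite mem_undup mem_filter; case: (boolP (is_part la && _)) => //= /andP[pla laN].
pose t : seq 'I_N.+1 := map inord la.
have szt : (size t <= N)%N.
  by rewrite size_map (leq_trans (size_part pla)).
apply/mapP; exists (Bseq szt); first by rewrite mem_enum.
rewrite /= -map_comp -[LHS]map_id; apply/eq_in_map => k kla /=.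
rewrite inordK // ltnS (leq_trans _ laN) // -(cat_take_drop (index k la) la).
rewrite sumn_cat (drop_nth 0%N) ?index_mem //= nth_index //.
by rewrite addnCA leq_addr.
Qed.

Lemma parts_upto_sub M N la : (M <= N)%N -> la \in parts_upto M ->
  la \in parts_upto N.
Proof.
by move=> MN; rewrite !mem_parts => /andP[-> /leq_trans ->].
Qed.

(** * Coefficients and degree of symmetric functions *)

Section Coefficients.
Context (R : comNzRingType).
Local Notation Lam := (symfun R).
Implicit Types (p q : Lam) (s t la mu : seq nat).

(** The coefficient of x^s; the number of variables is taken to be the length of
    s, which is harmless by stability and lets s range over untyped sequences. *)
Definition sf_coef s p : R := (p (size s))@_(Multinom (in_tuple s)).

Lemma mcoeff_sf p n (m : 'X_{1..n}) : (p n)@_m = sf_coef m p.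
Proof.
case: m => [[s szs]]; rewrite /sf_coef /=; move/eqP: (szs) => Es.
by case: n / Es szs => szs; congr (_@_ _); congr Multinom; apply: val_inj.
Qed.

Lemma sf_coef_scalar s : scalar (sf_coef s).
Proof. by move=> c p q; rewrite /sf_coef /= mcoeffD mcoeffZ. Qed.

HB.instance Definition _ s :=
  GRing.isLinear.Build R Lam R *%R (sf_coef s) (sf_coef_scalar s).

Lemma sf_coef_perm p s t : perm_eq s t -> sf_coef s p = sf_coef t p.
Proof.
move=> st; have sz : size s = size t by apply: perm_size.
have /issymP symp : p (size t) \is symmetric by have [] := sfP p.
have /tuple_permP[u Es] : perm_eq s (in_tuple t) by [].
have -> : sf_coef t p = (msym u (p (size t)))@_(Multinom (in_tuple t)).
  by rewrite symp.
rewrite mcoeff_sym mcoeff_sf; congr sf_coef; rewrite Es /=.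
by apply: eq_map => i; rewrite -multinomE.
Qed.

Lemma sf_coef_rcons0 p s : sf_coef (rcons s 0%N) p = sf_coef s p.
Proof.
have resp : mrestrict (p (size s).+1) = p (size s) by have [] := sfP p.
rewrite [RHS]/sf_coef -resp mcoeff_mrestrict mcoeff_sf.
by congr sf_coef.
Qed.

Lemma sf_coef_shape p s : sf_coef s p = sf_coef (shape_of s) p.
Proof.
rewrite (sf_coef_perm p (shape_perm s)).
elim: (count _ _) => [|n IH]; first by rewrite cats0.
by rewrite -addn1 nseqD catA cats1 sf_coef_rcons0.
Qed.

Lemma sf_coefP p q :
  (forall la, is_part la -> sf_coef la p = sf_coef la q) -> p = q.
Proof.
move=> pq; apply: sf_eqP => n; apply/mpolyP => m.
by rewrite !mcoeff_sf !(sf_coef_shape _ m) pq // is_part_shape.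
Qed.

Lemma sumn_mdeg n (m : 'X_{1..n}) : sumn m = mdeg m.
Proof. by rewrite sumnE /mdeg. Qed.

Lemma sf_coef_complete d s : sf_coef s (sf_complete R d) = (sumn s == d)%:R.
Proof.
by rewrite /sf_coef mcoeff_msum_of andbT -sumn_mdeg.
Qed.

Lemma sf_coef_monomial la mu : is_part la -> is_part mu ->
  sf_coef mu (sf_monomial R la) = (la == mu)%:R.
Proof.
move=> pla pmu; rewrite /sf_coef mcoeff_msum_of -sumn_mdeg /=.
rewrite filter_part // part_perm //.
by case: (la =P mu) => [->|]; rewrite ?eqxx ?andbF.
Qed.

(** Degree at most N, read off the coefficients rather than msize, so that it
    makes sense uniformly in the number of variables. *)
Definition degle N p := forall s, (N < sumn s)%N -> sf_coef s p = 0.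

Lemma degle_exists p : exists N, degle N p.
Proof.
have [_ _ [d pd]] := sfP p; exists d => s ds; rewrite /sf_coef.
apply/eqP; rewrite mcoeff_eq0; apply: msize_mdeg_ge.
by rewrite -sumn_mdeg (leq_trans (pd _)) // ltnW.
Qed.

Lemma degle_leq M N p : (M <= N)%N -> degle M p -> degle N p.
Proof. by move=> MN pM s Ns; apply: pM; apply: leq_ltn_trans Ns. Qed.

Lemma degleM M N p q : degle M p -> degle N q -> degle (M + N) (p * q).
Proof.
move=> pM qN s; rewrite /sf_coef /= => MNs; rewrite mcoeffM big1 // => -[a b] /=.
move=> /eqP Es; rewrite !mcoeff_sf.
have Ed : sumn s = (mdeg a + mdeg b)%N.
  by rewrite -mdegD -Es -sumn_mdeg.
have [Ma|aM] := ltnP M (mdeg a); first by rewrite pM ?mul0r // sumn_mdeg.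
rewrite qN ?mulr0 // sumn_mdeg ltnNge; apply/negP => bN.
by move: MNs; rewrite Ed ltnNge leq_add.
Qed.

Lemma degle_lin N c p q : degle N p -> degle N q -> degle N (c *: p + q).
Proof. by move=> pN qN s Ns; rewrite linearP /= pN ?qN // mulr0 addr0. Qed.

Lemma degle0 N : degle N 0.
Proof. by move=> s _; rewrite raddf0. Qed.

Lemma degle_sum N (I : Type) (r : seq I) (P : pred I) (c : I -> R)
    (F : I -> Lam) : (forall i, P i -> degle N (F i)) ->
  degle N (\sum_(i <- r | P i) c i *: F i).
Proof.
move=> FN; elim/big_ind: _ => [|p q pN qN|i Pi]; first exact: degle0.
  by rewrite -[p]scale1r; apply: degle_lin.
rewrite -[_ *: _]addr0; apply: degle_lin; [exact: FN|exact: degle0].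
Qed.

Lemma degle1 : degle 0 1.
Proof.
move=> s s0; rewrite /sf_coef /= mcoeff1; case: eqP => // sE.
have Es : sumn s = mdeg (Multinom (in_tuple s)) by rewrite -sumn_mdeg.
by move: s0; rewrite Es sE mdeg0.
Qed.

Lemma degle_complete d : degle d (sf_complete R d).
Proof. by move=> s ds; rewrite sf_coef_complete gtn_eqF. Qed.

Lemma degle_elem d : degle d (sf_elem R d).
Proof.
move=> s ds; rewrite /sf_coef /= mcoeff_mesym /mechar -sumn_mdeg /=.
by rewrite gtn_eqF.
Qed.

Lemma degle_complete_prod s : degle (sumn s) (sf_complete_prod R s).
Proof.
rewrite /sf_complete_prod; elim: s => [|d s IH] /=.
  by rewrite big_nil; exact: degle1.
by rewrite big_cons; apply: degleM IH; exact: degle_complete.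
Qed.

Lemma degle_monomial N la : is_part la -> (sumn la <= N)%N ->
  degle N (sf_monomial R la).
Proof.
move=> pla laN s Ns; rewrite sf_coef_shape sf_coef_monomial ?is_part_shape //.
by case: eqP => // las; move: Ns; rewrite -sumn_shape -las ltnNge laN.
Qed.

Lemma monomial_expansion N p : degle N p ->
  p = \sum_(mu <- parts_upto N) sf_coef mu p *: sf_monomial R mu.
Proof.
move=> pN; apply: sf_coefP => la pla; rewrite raddf_sum /=.
under eq_big_seq => mu muN.
  have pmu : is_part mu by move: muN; rewrite mem_parts => /andP[].
  rewrite linearZ /= sf_coef_monomial //; over.
have [laN|laN] := leqP (sumn la) N; last first.
  rewrite pN // big1_seq // => mu /andP[_]; rewrite mem_parts => /andP[_ muN].
  by case: eqP => [E|]; rewrite ?mulr0 //; move: muN; rewrite E leqNgt laN.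
rewrite (bigD1_seq la) ?mem_parts ?parts_upto_uniq ?pla //= eqxx mulr1.
by rewrite big1 ?addr0 // => mu /negbTE ->; rewrite mulr0.
Qed.

(** Each squarefree monomial of e_k shifts the exponents by the indicator of a
    k-subset. *)
Lemma mcoeff_mesymM n k (p : {mpoly R[n]}) (m : 'X_{1..n}) :
  (mesym n R k * p)@_m =
  \sum_(S : {set 'I_n} | (#|S| == k) && (mesym1 S <= m)%MM) p@_(m - mesym1 S).
Proof.
rewrite mesymE mulr_suml raddf_sum /= [in RHS]big_mkcondr /=.
apply: eq_bigr => S _; rewrite -commr_mpolyX; case: ifP => Sm.
  by rewrite -{1}(submK Sm) addmC mcoeffMX.
rewrite mcoeffMr big1 // => -[a b] /= /eqP E; rewrite mcoeffX.
case: eqP; rewrite ?mulr0 ?mul0r // => Eb; case/negP: (negbT Sm).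
by rewrite E Eb ?lem_addl ?lem_addr.
Qed.

End Coefficients.

(** * The products of complete functions span *)

Section Spanning.
Context (R : comNzRingType).
Local Notation Lam := (symfun R).
Local Notation h := (sf_complete R).
Local Notation e := (sf_elem R).
Local Notation hprod := (sf_complete_prod R).
Implicit Types (p q : Lam) (s t la mu : seq nat).

(** The product over i of 1 - [i in A], expanded; the factor at x vanishes. *)
Lemma sum_sign_subsets (I : finType) (A : {set I}) (x : I) : x \in A ->
  \sum_(S : {set I} | S \subset A) (-1) ^+ #|S| = 0 :> R.
Proof.
move=> xA.
have := @bigA_distr R 0 1 *%R +%R I (fun i => - (i \in A)%:R : R) (fun=> 1).
rewrite (bigD1 x) //= xA addNr mul0r => E; rewrite [RHS]E big_mkcond /=.
apply: eq_bigr => S _; case: ifP => SA; last first.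
  have /fintype.subsetPn[y yS yA] := negbT SA.
  by rewrite (bigD1 y) //= yS (negbTE yA) oppr0 mul0r.
rewrite -big_mkcond /= -prodr_const; apply: eq_bigr => i iS.
by rewrite (fintype.subsetP SA).
Qed.

(** At an exponent vector m of degree n, the coefficient of e_i h_(n-i) counts the
    i-subsets of the support of m, so that the alternating sum runs over all the
    subsets of a nonempty set. *)
Lemma elem_complete_rel n : (0 < n)%N ->
  \sum_(i < n.+1) (-1) ^+ i *: (e i * h (n - i)) = 0.
Proof.
move=> n0; apply: sf_coefP => la pla; rewrite [RHS]raddf0 raddf_sum /=.
set m := Multinom (in_tuple la).
have Em : mdeg m = sumn la by rewrite -sumn_mdeg.
have Esub (S : {set 'I_(size la)}) :
    (mesym1 S <= m)%MM = (S \subset [set i | (0 < m i)%N]).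
  apply/mnm_lepP/fintype.subsetP => [Sm i iS|Sm i].
    by have := Sm i; rewrite inE mnmE iS.
  by rewrite mnmE; case: (boolP (i \in S)) => // /Sm; rewrite inE.
have coefE (i : 'I_n.+1) : sf_coef la (e i * h (n - i)) =
    \sum_(S : {set 'I_(size la)} | (#|S| == i) && (mesym1 S <= m)%MM)
      (sumn la == n)%:R.
  rewrite /sf_coef [(_ * _ : Lam) _]/(_ * _) mcoeff_mesymM.
  apply: eq_bigr => S /andP[/eqP Si Sm]; rewrite mcoeff_sf sf_coef_complete.
  have mE : mdeg m = (mdeg (m - mesym1 S) + i)%N.
    by rewrite -Si -mdeg_mesym1 -mdegD submK.
  by rewrite sumn_mdeg -Em mE -(eqn_add2r i) subnK // -ltnS.
under eq_bigr => i _ do rewrite linearZ /= coefE mulr_sumr.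
have [lan|lan] := eqVneq (sumn la) n; last first.
  by rewrite big1 // => i _; rewrite big1 // => S _; rewrite mulr0.
(* Group the subsets of the support by cardinality. *)
transitivity (\sum_(S : {set _} | S \subset [set i | (0 < m i)%N]) (-1) ^+ #|S| : R).
  rewrite (partition_big (fun S : {set 'I_(size la)} => inord #|S| : 'I_n.+1)
    xpredT) //=.
  apply: eq_bigr => i _; apply: eq_big => S; last first.
    by case/andP=> /eqP -> _; rewrite mulr1.
  rewrite Esub andbC; case: (boolP (_ \subset _)) => //= Sm.
  have Sn : (#|S| < n.+1)%N.
    rewrite ltnS -lan -Em -(submK (_ : mesym1 S <= m)%MM) ?Esub //.
    by rewrite mdegD mdeg_mesym1 leq_addl.
  by rewrite -val_eqE /= inordK.
have /existsP[i mi] : [exists i, (0 < m i)%N].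
  apply: contraLR n0 => /existsPn m0; rewrite -lan -Em mdegE big1 // => i _.
  by have := m0 i; case: (m i).
by apply: (@sum_sign_subsets _ _ i); rewrite inE.
Qed.

(** The span of the products of degree at most N, not of all of them: the bound is
    what makes the transition matrix to monomial functions square. *)
Definition hspan N p :=
  exists c : seq nat -> R, p = \sum_(la <- parts_upto N) c la *: hprod la.

Lemma hspan0 N : hspan N 0.
Proof. by exists (fun=> 0); rewrite big1 // => la _; rewrite scale0r. Qed.

Lemma hspan_lin N a p q : hspan N p -> hspan N q -> hspan N (a *: p + q).
Proof.
move=> [c ->] [d ->]; exists (fun la => a * c la + d la).
rewrite scaler_sumr -big_split; apply: eq_bigr => la _ /=.
by rewrite scalerA scalerDl.
Qed.

Lemma hspan_sum N (I : eqType) (r : seq I) (c : I -> R) (F : I -> Lam) :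
  (forall i, i \in r -> hspan N (F i)) -> hspan N (\sum_(i <- r) c i *: F i).
Proof.
elim: r => [|i r IH] HF; first by rewrite big_nil; apply: hspan0.
rewrite big_cons; apply: hspan_lin; first by apply: HF; rewrite mem_head.
by apply: IH => j jr; apply: HF; rewrite inE jr orbT.
Qed.

Lemma elem0 : e 0 = 1.
Proof. by apply: sf_eqP => n /=; rewrite mesym0E. Qed.

Lemma complete0 : h 0 = 1.
Proof.
apply: sf_coefP => la pla; rewrite sf_coef_complete.
rewrite /sf_coef /= mcoeff1 -mdeg_eq0 -sumn_mdeg //.
Qed.

Lemma hprod_cat s t : hprod (s ++ t) = hprod s * hprod t.
Proof. exact: big_cat. Qed.

Lemma hprod_shape s : hprod s = hprod (shape_of s).
Proof.
rewrite /sf_complete_prod (perm_big _ (shape_perm s)) big_cat /=.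
rewrite [X in _ * X]big1_seq ?mulr1 // => d /andP[_].
by rewrite mem_nseq => /andP[_ /eqP ->]; rewrite complete0.
Qed.

Lemma hspan_hprod N s : (sumn s <= N)%N -> hspan N (hprod s).
Proof.
move=> sN; exists (fun la => (la == shape_of s)%:R).
rewrite (bigD1_seq (shape_of s)) ?parts_upto_uniq //=; last first.
  by rewrite mem_parts is_part_shape sumn_shape.
rewrite eqxx scale1r big1 ?addr0 -?hprod_shape // => la /negbTE ->.
by rewrite scale0r.
Qed.

Lemma hspan_leq M N p : (M <= N)%N -> hspan M p -> hspan N p.
Proof.
move=> MN [c ->]; apply: hspan_sum => la; rewrite mem_parts => /andP[_ laM].
by apply: hspan_hprod; apply: leq_trans MN.
Qed.

Lemma hspanM M N p q : hspan M p -> hspan N q -> hspan (M + N) (p * q).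
Proof.
move=> [c ->] [d ->]; rewrite mulr_suml.
under eq_bigr do rewrite -scalerAl.
apply: hspan_sum => la; rewrite mem_parts => /andP[_ laM].
rewrite mulr_sumr; under eq_bigr do rewrite -scalerAr -hprod_cat.
apply: hspan_sum => mu; rewrite mem_parts => /andP[_ muN].
by apply: hspan_hprod; rewrite sumn_cat leq_add.
Qed.

Lemma hspan1 N : hspan N 1.
Proof.
by have := @hspan_hprod N [::] (leq0n N); rewrite /sf_complete_prod big_nil.
Qed.

Lemma hspan_complete d : hspan d (h d).
Proof.
have := @hspan_hprod d [:: d]; rewrite /sf_complete_prod big_seq1 /= addn0.
exact.
Qed.

(** Solve the alternating relation for e_n and use induction on n. *)
Lemma hspan_elem n : hspan n (e n).
Proof.
elim/ltn_ind: n => -[_|n IH].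
  by rewrite elem0; exact: hspan1.
have := @elem_complete_rel n.+1 isT; rewrite big_ord_recr /= subnn complete0.
move/eqP; rewrite mulr1 addrC addr_eq0 => /eqP E.
rewrite -[e _](signrZK n.+1) E scalerN -scaleNr.
rewrite -[_ *: _]addr0; apply: hspan_lin; last exact: hspan0.
apply: hspan_sum => i _; rewrite -{1}(subnKC (ltnW (ltn_ord i))).
by apply: hspanM; [exact: IH|exact: hspan_complete].
Qed.

Lemma sf_val_sum (I : Type) (r : seq I) (P : pred I) (F : I -> Lam) n :
  (\sum_(i <- r | P i) F i) n = \sum_(i <- r | P i) F i n.
Proof. exact: (big_morph (fun p : Lam => p n)). Qed.

Lemma sf_val_prod (I : Type) (r : seq I) (P : pred I) (F : I -> Lam) n :
  (\prod_(i <- r | P i) F i) n = \prod_(i <- r | P i) F i n.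
Proof. exact: (big_morph (fun p : Lam => p n)). Qed.

Lemma sf_val_exp p k n : (p ^+ k) n = p n ^+ k.
Proof. by elim: k => // k IH; rewrite !exprS -IH. Qed.

(** A monomial of degree at most N involves at most N variables. *)
Lemma degle_inj N p q : degle N p -> degle N q -> p N = q N -> p = q.
Proof.
move=> pN qN pq; apply: sf_coefP => la pla.
have [laN|laN] := leqP (sumn la) N; last by rewrite pN ?qN.
have sz : size (la ++ nseq (N - size la) 0%N) == N.
  by rewrite size_cat size_nseq subnKC // (leq_trans (size_part pla)).
have E r : sf_coef la r = (r N)@_(Multinom (Tuple sz)).
  rewrite mcoeff_sf /=; elim: (N - _)%N {sz} => [|k IH]; first by rewrite cats0.
  by rewrite -addn1 nseqD catA cats1 sf_coef_rcons0.
by rewrite !E pq.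
Qed.

Lemma hspan_prod_exp (I : Type) (r : seq I) (F : I -> Lam) (d k : I -> nat) :
  (forall i, hspan (d i) (F i)) ->
  hspan (\sum_(i <- r) k i * d i)%N (\prod_(i <- r) F i ^+ k i).
Proof.
move=> Fd; elim: r => [|i r IH]; first by rewrite !big_nil; exact: hspan1.
rewrite !big_cons; apply: hspanM IH.
elim: (k i) => [|j IH]; first exact: hspan1.
by rewrite exprS mulSn; apply: hspanM.
Qed.

(** By the fundamental theorem in N variables, p is a polynomial in the e_i whose
    weight is bounded by N; the same polynomial in the symmetric functions e_i has
    degree at most N, hence agrees with p. *)
Lemma hspanP N p : degle N p -> hspan N p.
Proof.
move=> pN; have psym : p N \is symmetric by have [] := sfP p.
have [t [tp tw]] := sym_fundamental psym.
pose q := \sum_(m <- msupp t) t@_m *: \prod_(i < N) e i.+1 ^+ m i.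
have qN : hspan N q.
  apply: hspan_sum => m mt; apply: (@hspan_leq (\sum_(i < N) m i * i.+1)); last first.
    by apply: hspan_prod_exp => i; exact: hspan_elem.
  (* The degree of the product is the weight of the exponent m in t. *)
  rewrite -ltnS -[X in (X < _)%N]/(mnmwgt m).
  apply: (leq_trans (mmeasure_mnm_lt _ mt)); apply: leq_trans tw _.
  rewrite msizeE; apply/bigmax_leqP_seq => k; rewrite mcoeff_msupp mcoeff_sf.
  rewrite ltnS leqNgt -sumn_mdeg => nz _; apply: contra nz => Nk.
  by rewrite pN.
have qd : degle N q.
  have [c ->] := qN; rewrite big_seq; apply: degle_sum => la.
  rewrite mem_parts => /andP[_ laN]; apply: degle_leq laN _.
  exact: degle_complete_prod.
rewrite (degle_inj pN qd) // -tp /q comp_mpolyE sf_val_sum; apply: eq_bigr => m _ /=.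
congr (_ *: _); rewrite sf_val_prod; apply: eq_bigr => i _.
by rewrite sf_val_exp tnth_mktuple.
Qed.

End Spanning.

(** * Products of linear polynomials *)

(** Expand the product by choosing, for the indices in S, the term in X. *)
Lemma coef_prod_linear (A : comNzRingType) k (a b : 'I_k -> A) n :
  (\prod_i ((a i)%:P + 'X * (b i)%:P))`_n =
  \sum_(S : {set 'I_k} | #|S| == n) \prod_i (if i \in S then b i else a i).
Proof.
under eq_bigr do rewrite addrC.
rewrite bigA_distr coef_sum [RHS]big_mkcond /=; apply: eq_bigr => S _.
rewrite (_ : \prod_i _ = 'X^#|S| * (\prod_i (if i \in S then b i else a i))%:P).
  by rewrite coefMC coefXn eq_sym; case: eqP; rewrite ?mul1r ?mul0r.
rewrite rmorph_prod -prodr_const [X in X * _]big_mkcond -big_split /=.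
by apply: eq_bigr => i _; case: ifP; rewrite ?mul1r.
Qed.

Lemma coef_prod_linear_top (A : comNzRingType) k (a b : 'I_k -> A) :
  (\prod_i ((a i)%:P + 'X * (b i)%:P))`_k = \prod_i b i.
Proof.
rewrite coef_prod_linear (big_pred1 [set: 'I_k]) => [|S] /=.
  by apply: eq_bigr => i _; rewrite inE.
by rewrite [RHS]eqEcard finset.subsetT cardsT card_ord eqn_leq
   -[X in (_ <= X)%N]card_ord max_card.
Qed.

Lemma coef_prod_linear_gt (A : comNzRingType) k (a b : 'I_k -> A) n :
  (k < n)%N -> (\prod_i ((a i)%:P + 'X * (b i)%:P))`_n = 0.
Proof.
move=> kn; rewrite coef_prod_linear big_pred0 // => S.
by rewrite ltn_eqF // (leq_ltn_trans (max_card _)) ?card_ord.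
Qed.

(** * Freeness of the products of complete functions, and the Hall form *)

Section HallForm.
Context (R : comNzRingType).
Local Notation Lam := (symfun R).
Local Notation h := (sf_complete R).
Local Notation e := (sf_elem R).
Local Notation hprod := (sf_complete_prod R).
Implicit Types (p q : Lam) (s t la mu : seq nat).

(** If B expands the monomial functions of degree at most N in the products h_la
    and A expands the latter in the former, then B A = 1; both are square over a
    commutative ring, so A B = 1, which gives independence. *)
Lemma hprod_free N (c : seq nat -> R) :
  \sum_(la <- parts_upto N) c la *: hprod la = 0 ->
  forall la, la \in parts_upto N -> c la = 0.
Proof.
set P := parts_upto N; pose n := size P; pose part (i : 'I_n) := nth [::] P i.
have partP i : part i \in P by apply: mem_nth.
have sumP (V : nmodType) (F : seq nat -> V) :
  \sum_(la <- P) F la = \sum_(i < n) F (part i).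
  by rewrite (big_nth [::]) big_mkord.
have mspan (i : 'I_n) : exists b : seq nat -> R,
    sf_monomial R (part i) = \sum_(j < n) b (part j) *: hprod (part j).
  have := partP i; rewrite mem_parts => /andP[pi iN].
  have [b bE] := hspanP (degle_monomial R pi iN).
  by exists b; rewrite -(sumP _ (fun la => b la *: hprod la)).
have [b bE] := choice mspan.
pose A : 'M[R]_n := \matrix_(i, j) sf_coef (part j) (hprod (part i)).
pose B : 'M[R]_n := \matrix_(i, j) b i (part j).
have BA1 : B *m A = 1%:M.
  apply/matrixP => i k; rewrite !mxE.
  transitivity (sf_coef (part k) (sf_monomial R (part i))).
    rewrite bE raddf_sum /=; apply: eq_bigr => j _.
    by rewrite !mxE linearZ.
  have := partP i; have := partP k; rewrite !mem_parts.
  move=> /andP[pk _] /andP[pi _]; rewrite sf_coef_monomial //.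
  by rewrite nth_uniq ?parts_upto_uniq.
have AB1 := mulmx1C BA1.
rewrite sumP => c0 la laP.
pose v : 'rV[R]_n := \row_i c (part i).
have vA : v *m A = 0.
  apply/rowP => k; rewrite !mxE -[RHS](raddf0 (sf_coef (part k))) -c0 raddf_sum /=.
  by apply: eq_bigr => j _; rewrite !mxE linearZ.
have v0 : v = 0 by rewrite -[v]mulmx1 -AB1 mulmxA vA mul0mx.
have laN : (index la P < n)%N by rewrite index_mem.
have /rowP/(_ (Ordinal laN)) := v0; rewrite !mxE /part /= nth_index //.
Qed.

Lemma sum_parts_widen (M : lmodType R) (v : seq nat -> M) N K
    (a : seq nat -> R) : (N <= K)%N ->
  \sum_(la <- parts_upto N) a la *: v la =
  \sum_(la <- parts_upto K) (if la \in parts_upto N then a la else 0) *: v la.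
Proof.
move=> NK; rewrite [RHS](bigID (fun la => la \in parts_upto N)) /=.
rewrite [X in _ + X]big1 => [|la /negbTE ->]; last by rewrite scale0r.
rewrite addr0 [RHS](eq_bigr (fun la => a la *: v la)) => [|la ->] //.
rewrite -[RHS]big_filter.
apply: perm_big; apply: uniq_perm; rewrite ?filter_uniq ?parts_upto_uniq //.
by move=> la; rewrite mem_filter andb_idr // => /(parts_upto_sub NK).
Qed.

(** This makes the linear extension of v from the h_la well defined: two expansions
    of one symmetric function, possibly with different degree bounds, have the same
    image. *)
Lemma hprod_sum_transfer (M : lmodType R) (v : seq nat -> M) N K
    (a b : seq nat -> R) :
  \sum_(la <- parts_upto N) a la *: hprod la =
  \sum_(la <- parts_upto K) b la *: hprod la ->
  \sum_(la <- parts_upto N) a la *: v la =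
  \sum_(la <- parts_upto K) b la *: v la.
Proof.
rewrite !(sum_parts_widen _ _ (leq_maxl N K)) !(sum_parts_widen _ _ (leq_maxr N K)).
move/eqP; rewrite -subr_eq0 -sumrB; under eq_bigr do rewrite -scalerBl.
move/eqP/hprod_free => ab; apply: eq_big_seq => la /ab /eqP.
by rewrite subr_eq0 => /eqP ->.
Qed.

Lemma hprod_expansion p :
  exists Nc : nat * (seq nat -> R),
    p = \sum_(la <- parts_upto Nc.1) Nc.2 la *: hprod la.
Proof.
have [N pN] := degle_exists p; have [c pE] := hspanP pN.
by exists (N, c).
Qed.

Lemma hprod_ind (P : Lam -> Prop) :
  P 0 -> (forall c la p, is_part la -> P p -> P (c *: hprod la + p)) ->
  forall p, P p.
Proof.
move=> P0 PS p; have [[N c] /= ->] := hprod_expansion p.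
have : all (@is_part) (parts_upto N).
  by apply/allP => la; rewrite mem_parts => /andP[].
elim: (parts_upto N) => [|la r IH] /=; first by rewrite big_nil.
by case/andP=> pla /IH; rewrite big_cons; apply: PS.
Qed.

(** An expansion is chosen for every p; the value obtained does not depend on that
    choice (hprod_sum_transfer), and is therefore linear in p. *)
Lemma linear_ext_exists (M : lmodType R) (v : seq nat -> M) :
  exists L : Lam -> M,
    linear L /\ forall la, is_part la -> L (hprod la) = v la.
Proof.
have [f fE] := choice hprod_expansion.
exists (fun p => \sum_(la <- parts_upto (f p).1) (f p).2 la *: v la); split.
  move=> c p q; rewrite (sum_parts_widen v _ (leq_maxl (f p).1 (f q).1)).
  rewrite (sum_parts_widen v _ (leq_maxr (f p).1 (f q).1)).
  rewrite scaler_sumr -big_split /=; under [RHS]eq_bigr do rewrite scalerA -scalerDl.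
  apply: hprod_sum_transfer; rewrite -fE {1}(fE p) {1}(fE q).
  rewrite (sum_parts_widen _ _ (leq_maxl (f p).1 (f q).1)).
  rewrite (sum_parts_widen _ _ (leq_maxr (f p).1 (f q).1)).
  rewrite scaler_sumr -big_split /=; apply: eq_bigr => la _.
  by rewrite scalerA scalerDl.
move=> la pla; have laP : la \in parts_upto (sumn la) by rewrite mem_parts pla /=.
have single (V : lmodType R) (w : seq nat -> V) : w la =
    \sum_(mu <- parts_upto (sumn la)) (mu == la)%:R *: w mu.
  rewrite (bigD1_seq la) ?parts_upto_uniq //= eqxx scale1r big1 ?addr0 //.
  by move=> mu /negbTE ->; rewrite scale0r.
by rewrite [RHS]single; apply: hprod_sum_transfer; rewrite -fE [LHS]single.
Qed.

Lemma linear_map0 (U V : lmodType R) (L : U -> V) : linear L -> L 0 = 0.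
Proof.
by move=> linL; have := linL (-1) 0 0; rewrite !scaleN1r !addNr.
Qed.

Lemma linear_mapZ (U V : lmodType R) (L : U -> V) : linear L ->
  forall c x, L (c *: x) = c *: L x.
Proof.
by move=> linL c x; rewrite -[c *: x]addr0 linL linear_map0 // addr0.
Qed.

Lemma linear_eq (V : lmodType R) (L L' : Lam -> V) : linear L -> linear L' ->
  (forall la, is_part la -> L (hprod la) = L' (hprod la)) -> L =1 L'.
Proof.
move=> linL linL' LL'; apply: hprod_ind; first by rewrite !linear_map0.
by move=> c la p pla E; rewrite linL linL' E LL'.
Qed.

(** The form is p |-> <p, q>, extended from h_la |-> coefficient of x^la in q; its
    linearity in q can be tested on the basis. *)
Lemma hall_exists : exists B : Lam -> Lam -> R, is_hall B.
Proof.
have [f fP] := choice (fun q => linear_ext_exists (fun la => sf_coef la q : R^o)).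
exists (fun p q => f q p); split=> [p c q r|q|la mu pla pmu].
- pose L p := c *: f q p + f r p : R^o.
  apply: (@linear_eq R^o _ L) p; first by case: (fP (c *: q + r)).
    move=> a x y; rewrite /L; have [-> _] := fP q; have [-> _] := fP r.
    by rewrite !scalerDr addrACA !scalerA mulrC.
  move=> la pla; rewrite /L; have [_ ->//] := fP q; have [_ ->//] := fP r.
  by have [_ ->//] := fP (c *: q + r); rewrite linearP.
- by case: (fP q).
- by have [_ ->//] := fP (sf_monomial R mu); rewrite sf_coef_monomial // eq_sym.
Qed.

Lemma hallP : is_hall (@hall R).
Proof. exact: xgetPex hall_exists. Qed.

Lemma hall_linear_l q : linear (fun p => hall p q : R^o).
Proof. by have [_ + _] := hallP; apply. Qed.

Lemma hall_linear_r p : linear (fun q => hall p q : R^o).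
Proof. by have [+ _ _] := hallP; apply. Qed.

Lemma linear_map_sum (U V : lmodType R) (L : U -> V) (I : Type) (r : seq I)
    (P : pred I) (c : I -> R) (F : I -> U) : linear L ->
  L (\sum_(i <- r | P i) c i *: F i) = \sum_(i <- r | P i) c i *: L (F i).
Proof.
move=> linL; elim: r => [|i r IH]; first by rewrite !big_nil linear_map0.
by rewrite !big_cons; case: ifP => // _; rewrite linL IH.
Qed.

(** The sequence s need be neither sorted nor free of zeros, which is what the
    shifted exponents of the adjoint of e_n require. *)
Lemma hall_hprod s q : hall (hprod s) q = sf_coef s q.
Proof.
rewrite hprod_shape sf_coef_shape; have := is_part_shape s.
move: (shape_of s) => la pla; have [N qN] := degle_exists q.
rewrite (monomial_expansion qN) raddf_sum /=.
rewrite (linear_map_sum _ _ _ _ (hall_linear_r _)).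
apply: eq_big_seq => mu; rewrite mem_parts => /andP[pmu _].
rewrite linearZ /= sf_coef_monomial //; have [_ _ ->//] := hallP.
by rewrite eq_sym.
Qed.

(** The coordinates of p on the h_la are its pairings with the monomial functions. *)
Lemma hall_nondegenerate p p' : (forall q, hall p q = hall p' q) -> p = p'.
Proof.
move=> pp'; have [N pN] := degle_exists p; have [N' pN'] := degle_exists p'.
have coordE K (c : seq nat -> R) mu : mu \in parts_upto K ->
    hall (\sum_(la <- parts_upto K) c la *: hprod la) (sf_monomial R mu) = c mu.
  move=> muK; rewrite (linear_map_sum _ _ _ _ (hall_linear_l _)).
  have pmu : is_part mu by move: muK; rewrite mem_parts => /andP[].
  rewrite (bigD1_seq mu) ?parts_upto_uniq //= hall_hprod sf_coef_monomial //.
  rewrite eqxx [_ *: _]mulr1 big_seq_cond big1 ?addr0 // => la.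
  rewrite mem_parts => /andP[/andP[pla _]] lamu.
  by rewrite hall_hprod sf_coef_monomial // eq_sym (negbTE lamu) [LHS]mulr0.
have [c cE] := hspanP (degle_leq (leq_maxl N N') pN).
have [c' cE'] := hspanP (degle_leq (leq_maxr N N') pN').
rewrite cE cE'; apply: eq_big_seq => mu muK; congr (_ *: _).
by rewrite -(coordE _ c _ muK) -(coordE _ c' _ muK) -cE -cE' pp'.
Qed.

(** Nondegeneracy leaves a single adjoint for perp to pick. *)
Lemma perp_unique (f : Lam) T : is_perp f T -> perp f = T.
Proof.
move=> fT; have [_ adj] : is_perp f (perp f) by apply: xgetI fT.
have [_ adjT] := fT; apply/funext => p; apply: hall_nondegenerate => q.
by rewrite adj adjT.
Qed.

(** * Skewing by elementary functions *)

Definition complete_pred d : Lam := if d is k.+1 then h k else 0.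

(** The image of h_s under sum_n (perp e_n) X^n. *)
Definition hpoly s : {poly Lam} :=
  \prod_(d <- s) ((h d)%:P + 'X * (complete_pred d)%:P).

Lemma hpoly_shape s : hpoly s = hpoly (shape_of s).
Proof.
rewrite /hpoly (perm_big _ (shape_perm s)) big_cat /=.
rewrite [X in _ * X]big1_seq ?mulr1 // => d /andP[_].
rewrite mem_nseq => /andP[_ /eqP ->]; rewrite complete0 /=.
by rewrite polyC0 mulr0 addr0.
Qed.

Lemma hprod_mnm k (m : 'X_{1..k}) : hprod m = \prod_(i < k) h (m i).
Proof.
case: m => t; rewrite /sf_complete_prod big_tuple.
by apply: eq_bigr => i _; rewrite multinomE.
Qed.

(** Both sides are sums over the n-subsets S of positions: in the product S selects
    the factors lowered by one, in e_n q it lowers the exponents. A zero entry at a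
    selected position kills the term on either side. *)
Lemma hall_coef_hpoly s n q : hall (hpoly s)`_n q = sf_coef s (e n * q).
Proof.
set m := Multinom (in_tuple s).
have mE (i : 'I_(size s)) : m i = nth 0%N s i by rewrite (mnm_nth 0%N).
rewrite [RHS]/sf_coef [(_ * _ : Lam) _]/(_ * _) mcoeff_mesymM.
rewrite /hpoly (big_nth 0%N) big_mkord coef_prod_linear.
under eq_bigr => S _ do under eq_bigr do rewrite -mE.
have prodS (S : {set 'I_(size s)}) :
    \prod_i (if i \in S then complete_pred (m i) else h (m i))
    = (mesym1 S <= m)%MM%:R *: hprod (m - mesym1 S)%MM.
  case: (boolP (_ <= _)%MM) => [/mnm_lepP Sm|nSm].
    rewrite scale1r hprod_mnm; apply: eq_bigr => i _.
    rewrite mnmBE mnmE; have := Sm i; rewrite mnmE.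
    by case: (i \in S); rewrite ?subn0 //; case: (m i) => // k; rewrite subn1.
  rewrite scale0r; have [i mi] : exists i, ~~ (mesym1 S i <= m i)%N.
    apply/existsP; apply: contraNT nSm => /existsPn Sm.
    by apply/mnm_lepP => i; have := Sm i; rewrite negbK.
  move: mi; rewrite mnmE (bigD1 i) //=; case: (i \in S) => //=.
  by case: (m i) => //= _; rewrite mul0r.
under eq_bigr do rewrite prodS.
rewrite (linear_map_sum _ _ _ _ (hall_linear_l _)) [RHS]big_mkcondr.
apply: eq_bigr => S _; rewrite hall_hprod mcoeff_sf; case: ifP => _.
  exact: mul1r.
exact: mul0r.
Qed.

(** The adjoint of e_n exists: prescribing hpoly on the basis gives one, and the
    pairing is checked there. *)
Lemma perp_elemP n :
  is_perp (e n) (perp (e n)) /\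
  forall s, perp (e n) (hprod s) = (hpoly s)`_n.
Proof.
have [T [linT TE]] := linear_ext_exists (fun la => (hpoly la)`_n).
suff perpT : is_perp (e n) T.
  rewrite (perp_unique perpT); split=> // s.
  by rewrite hprod_shape TE ?is_part_shape // -hpoly_shape.
split=> // p q; move: p.
apply: (@linear_eq R^o); last first.
- by move=> la pla; rewrite TE // hall_coef_hpoly hall_hprod.
- exact: hall_linear_l.
- by move=> c p p'; rewrite linT hall_linear_l.
Qed.

Lemma perp_elem_linear n : linear (perp (e n)).
Proof. by have [[]] := perp_elemP n. Qed.

Lemma perp_elem_hprod n s : perp (e n) (hprod s) = (hpoly s)`_n.
Proof. by have [_] := perp_elemP n. Qed.

(** The Leibniz rule for e_n, whose coproduct is the sum of the e_i (x) e_(n-i);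
    bilinearity reduces it to products h_la, on which hpoly is multiplicative. *)
Lemma perp_elemM n p q :
  perp (e n) (p * q) = \sum_(i < n.+1) perp (e i) p * perp (e (n - i)) q.
Proof.
move: p; apply: hprod_ind => [|c la p _ IHp].
  rewrite mul0r linear_map0; last exact: perp_elem_linear.
  rewrite big1 // => i _; rewrite linear_map0 ?mul0r //.
  exact: perp_elem_linear.
under eq_bigr do rewrite perp_elem_linear mulrDl -scalerAl.
rewrite big_split -scaler_sumr -IHp mulrDl -scalerAl perp_elem_linear /=.
congr (_ *: _ + _) => {p IHp}.
move: q; apply: hprod_ind => [|d mu q _ IHq].
  rewrite mulr0 linear_map0; last exact: perp_elem_linear.
  rewrite big1 // => i _; rewrite [X in _ * X]linear_map0 ?mulr0 //.
  exact: perp_elem_linear.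
under eq_bigr do rewrite [perp (e (n - _)) _]perp_elem_linear mulrDr -scalerAr.
rewrite big_split -scaler_sumr -IHq mulrDr -scalerAr perp_elem_linear /=.
congr (_ *: _ + _) => {q IHq}.
rewrite -hprod_cat perp_elem_hprod /hpoly big_cat coefM.
by apply: eq_bigr => i _; rewrite !perp_elem_hprod.
Qed.

(** * The generating polynomial of the skewings *)

(** A relation rather than a map: a polynomial attached to every p would require a
    bound on the n for which perp e_n p is nonzero. *)
Definition skews_to p (P : {poly Lam}) := forall n, perp (e n) p = P`_n.

Lemma skews_to_lin c p q P Q : skews_to p P -> skews_to q Q ->
  skews_to (c *: p + q) (c%:A *: P + Q).
Proof.
by move=> pP qQ n; rewrite perp_elem_linear coefD coefZ pP qQ mulr_algl.
Qed.

Lemma skews_to0 : skews_to 0 0.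
Proof.
by move=> n; rewrite coef0 linear_map0 //; exact: perp_elem_linear.
Qed.

Lemma skews_to1 : skews_to 1 1.
Proof.
move=> n; have := perp_elem_hprod n [::].
by rewrite /sf_complete_prod /hpoly !big_nil.
Qed.

Lemma skews_to_complete d :
  skews_to (h d) ((h d)%:P + 'X * (complete_pred d)%:P).
Proof.
move=> n; have := perp_elem_hprod n [:: d].
by rewrite /sf_complete_prod /hpoly !big_seq1.
Qed.

Lemma skews_toD p q P Q : skews_to p P -> skews_to q Q ->
  skews_to (p + q) (P + Q).
Proof.
by move=> pP qQ; have := skews_to_lin 1 pP qQ; rewrite !scale1r.
Qed.

Lemma skews_toM p q P Q : skews_to p P -> skews_to q Q ->
  skews_to (p * q) (P * Q).
Proof.
by move=> pP qQ n; rewrite perp_elemM coefM; apply: eq_bigr => i _; rewrite pP qQ.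
Qed.

Lemma skews_to_sign (b : bool) : skews_to ((-1) ^+ b) ((-1) ^+ b).
Proof.
case: b; last exact: skews_to1.
by have := skews_to_lin (-1) skews_to1 skews_to0; rewrite !addr0 !scaleN1r.
Qed.

Lemma skews_to_sum (I : Type) (r : seq I) (P : pred I) (F : I -> Lam)
    (G : I -> {poly Lam}) : (forall i, P i -> skews_to (F i) (G i)) ->
  skews_to (\sum_(i <- r | P i) F i) (\sum_(i <- r | P i) G i).
Proof.
by move=> FG; apply: big_ind2 => //; [exact: skews_to0|move=> *; exact: skews_toD].
Qed.

Lemma skews_to_prod (I : Type) (r : seq I) (P : pred I) (F : I -> Lam)
    (G : I -> {poly Lam}) : (forall i, P i -> skews_to (F i) (G i)) ->
  skews_to (\prod_(i <- r | P i) F i) (\prod_(i <- r | P i) G i).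
Proof.
by move=> FG; apply: big_ind2 => //; [exact: skews_to1|move=> *; exact: skews_toM].
Qed.

Lemma skews_to_det l (A : 'M[Lam]_l) (B : 'M[{poly Lam}]_l) :
  (forall i j, skews_to (A i j) (B i j)) -> skews_to (\det A) (\det B).
Proof.
move=> AB; apply: skews_to_sum => s _; apply: skews_toM; first exact: skews_to_sign.
by apply: skews_to_prod => i _.
Qed.

(** The coefficients of k_m^(r) on the h_(m-i) do not depend on m, so lowering every
    h by one lowers m by one; the term i = m disappears, as h_(-1) = 0. *)
Lemma skews_to_kfun r (m : int) :
  skews_to (kfun R r m) ((kfun R r m)%:P + 'X * (kfun R r (m - 1))%:P).
Proof.
case: m => [n|n]; last first.
  rewrite (_ : kfun R r (Negz n - 1) = 0) //=.
  by rewrite polyC0 mulr0 addr0; exact: skews_to0.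
have -> : kfun R r (n%:Z - 1) =
    \sum_(i < n.+1) 'C((r + i).-1, i)%:R *: complete_pred (n - i).
  case: n => [|n]; first by rewrite big_ord1 scaler0.
  have -> : n.+1%:Z - 1 = n by rewrite intS addrC addKr.
  rewrite big_ord_recr /= subnn scaler0 addr0.
  by apply: eq_bigr => i _; rewrite subSn // -ltnS.
rewrite /= [in X in _ + X]rmorph_sum rmorph_sum mulr_sumr -big_split /=.
apply: skews_to_sum => i _; set c := _%:R.
have polyCZ x : (c *: x)%:P = c%:A *: x%:P :> {poly Lam}.
  by rewrite -mul_polyC -polyCM mulr_algl.
have := skews_to_lin c (skews_to_complete (n - i)) skews_to0.
by rewrite !addr0 !polyCZ scalerDr -scalerAr.
Qed.

(** Each term of the determinant over the polynomial ring is a product of l linear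
    factors: its degree is at most l, with top coefficient the product of the slopes. *)
Lemma perp_elem_det l n (A B : 'M[Lam]_l) :
  (forall i j, skews_to (A i j) ((A i j)%:P + 'X * (B i j)%:P)) ->
  (l <= n)%N -> perp (e n) (\det A) = if n == l then \det B else 0.
Proof.
move=> AB ln.
have -> : perp (e n) (\det A) =
    (\det (\matrix_(i, j) ((A i j)%:P + 'X * (B i j)%:P)))`_n.
  by apply: skews_to_det => i j; rewrite mxE; exact: AB.
rewrite coef_sum.
have coefE (s : 'S_l) : ((-1) ^+ s * \prod_i (\matrix_(i, j)
    ((A i j)%:P + 'X * (B i j)%:P)) i (s i))`_n =
    if n == l then (-1) ^+ s * \prod_i B i (s i) else 0.
  under eq_bigr do rewrite mxE.
  rewrite -signr_odd -polyC1 -polyCN -rmorphXn coefCM.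
  move: ln; rewrite leq_eqVlt eq_sym; case: eqP => [-> _|_ /= ln].
    by rewrite coef_prod_linear_top signr_odd.
  by rewrite coef_prod_linear_gt // mulr0.
under eq_bigr do rewrite coefE.
by case: eqP => // _; rewrite big1.
Qed.

Lemma perpZ_elem c n : perp (c *: e n) = fun p => c *: perp (e n) p.
Proof.
have [[linT adj] _] := perp_elemP n.
apply: perp_unique; split=> [a p q|p q].
  by rewrite linT scalerDr !scalerA mulrC.
rewrite [LHS](linear_mapZ (hall_linear_l q)) adj -scalerAl.
by rewrite [RHS](linear_mapZ (hall_linear_r p)).
Qed.

Lemma G1_0 l : G1 R l 0 = e l.
Proof.
case: l => [|l] /=; first by rewrite elem0.
by rewrite expr0 mul1r !addn0 binn scale1r.
Qed.

Lemma G1_multiple l i : exists c, G1 R l i = c *: e (l + i).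
Proof.
case: l => [|l] /=; last by eexists.
case: i => [|i]; first by exists 1; rewrite scale1r elem0.
by exists 0; rewrite scale0r.
Qed.

End HallForm.

Theorem theorem1p2 (R : comNzRingType) (l : nat) (la : l.-tuple nat)
    (la_part : is_part la) :
  perp_series (G1 R l) (dual_grothendieck R (fun i => (tnth la i)%:Z))
  = dual_grothendieck R (fun i => (tnth la i)%:Z - 1).
Proof.
rewrite /perp_series /dual_grothendieck.
set g := \det _; set g' := \det _.
have perpg n : (l <= n)%N -> perp (sf_elem R n) g = if n == l then g' else 0.
  apply: perp_elem_det => i j; rewrite !mxE.
  by rewrite [_ - 1 + _]addrAC [_ - 1 - _]addrAC; exact: skews_to_kfun.
have term i : perp (G1 R l i) g = if i == 0%N then g' else 0.
  case: i => [|i]; first by rewrite G1_0 perpg ?leqnn ?eqxx.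
  have [c ->] := G1_multiple R l i.+1; rewrite perpZ_elem perpg ?leq_addr //.
  by rewrite gtn_eqF ?scaler0 // addnS ltnS leq_addr.
rewrite -(@fsbig_widen _ _ _ _ [set 0%N]%classic) //.
  by rewrite fsbig_set1 term eqxx.
by move=> i [_ /= i0]; rewrite term; case: eqP.
Qed.
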